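(* Let $G=(V,E)$ be a graph with $n$ vertices and maximum degree $\Delta$. Given a maximal independent set $S$ of $G$ (maintained in the data structure described in the context), one can, in $O(n\Delta)$ time, either find a maximal independent set $S'$ in the 2-neighborhood of $S$ with $|S'|<|S|$, or conclude that $S$ is 2-minimal.
   Context: $G=(V,E)$ is a simple undirected graph, $N(v)=\{u\mid uv\in E\}$, $\deg(v)=|N(v)|$, $\Delta=\max_v\deg(v)$. A solution is a maximal independent set of $G$. For a solution $S$ and $v\notin S$, the tightness of $v$ is $\tau(v)=|N(v)\cap S|$; $v$ is $t$-tight if $\tau(v)=t$, and $T_t$ denotes the set of $t$-tight vertices. A 2-swap on $S$ produces a solution $(S\setminus D)\cup A$ with $D$ a 2-element subset of $S$ and $A$ a nonempty subset of $V\setminus S$; the 2-neighborhood of $S$ is the set of all solutions so obtainable; $S$ is 2-minimal if its 2-neighborhood contains no solution of size smaller than $|S|$. Data structure: the graph is stored by adjacency lists; the current solution is maintained by an ordering of $V$ partitioned into consecutive sections $S$, $T_0$, $T_1$, $T_2$, $T_{\ge 3}$ (with the size of each section stored), together with $\tau(v)$ for every non-solution vertex; this supports scanning each section in time linear in its size, testing membership in $S$ in $O(1)$ time, and adding or dropping a vertex $v$ to/from the solution in $O(\deg(v))$ time; each vertex also carries auxiliary integer counters readable and writable in $O(1)$ time. *)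

(* Defs.v *)
From mathcomp Require Import all_boot all_order all_algebra.
Set Implicit Arguments.
Unset Strict Implicit.
Unset Printing Implicit Defensive.

Record sgraph := SGraph {
  vertex :> finType;
  edge : rel vertex;
  edge_sym : symmetric edge;
  edge_irrefl : irreflexive edge
}.

Definition nbrs (G : sgraph) (v : G) : {set G} := [set u | edge v u].
Definition deg (G : sgraph) (v : G) : nat := #|nbrs v|.
Definition maxdeg (G : sgraph) : nat := \max_(v : G) deg v.

Definition independent (G : sgraph) (S : {set G}) : bool :=
  [forall u in S, forall v in S, ~~ edge u v].

Definition is_solution (G : sgraph) (S : {set G}) : bool :=
  maxset (@independent G) S.

Definition tightness (G : sgraph) (S : {set G}) (v : G) : nat :=
  #|nbrs v :&: S|.

Definition tight (G : sgraph) (S : {set G}) (t : nat) : {set G} :=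
  [set v | (v \notin S) && (tightness S v == t)].

Definition in_2nbhd (G : sgraph) (S S' : {set G}) : Prop :=
  is_solution S' /\
  exists D A : {set G},
    [/\ D \subset S, #|D| = 2, A != set0, A \subset ~: S
      & S' = (S :\: D) :|: A].

Definition two_minimal (G : sgraph) (S : {set G}) : Prop :=
  forall S' : {set G}, in_2nbhd S S' -> ~ #|S'| < #|S|.

Inductive section := SecS | SecT0 | SecT1 | SecT2 | SecT3up.

Definition section_set (G : sgraph) (S : {set G}) (k : section) : {set G} :=
  match k with
  | SecS => S
  | SecT0 => tight S 0
  | SecT1 => tight S 1
  | SecT2 => tight S 2
  | SecT3up => [set v | (v \notin S) && (3 <= tightness S v)]
  end.

(* The ordering of V is L SecS ++ L SecT0 ++ L SecT1 ++ L SecT2 ++ L SecT3up;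
   it is given by its five consecutive sections. *)
Definition layout (G : sgraph) := section -> seq G.

Definition layout_of (G : sgraph) (S : {set G}) (L : layout G) : Prop :=
  forall k, uniq (L k) /\ L k =i section_set S k.

(* How G is stored: its adjacency lists, in any order, and the way in which
   the sections are rearranged when the solution S becomes S'. The order inside
   the sections after an update is left to the implementation: relayout is any
   function that yields a correct layout. *)
Record storage (G : sgraph) := Storage {
  adj : G -> seq G;
  adj_uniq : forall v, uniq (adj v);
  adj_nbrs : forall v, adj v =i nbrs v;
  relayout : layout G -> {set G} -> {set G} -> layout G;
  relayout_ok : forall L S S',
    layout_of S L -> layout_of S' (relayout L S S')
}.

(* Programs do not mention the graph. Every nat below is the name of a variable
   (an integer variable, a vertex variable, a pointer into an adjacency list)
   or of one of the per-vertex counters. *)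
Inductive iexp :=
  | Const of int
  | IVar of nat
  | SecSize of section
  | Tau of nat                    (* vertex variable *)
  | Counter of nat & nat          (* counter, vertex variable *)
  | Plus of iexp & iexp
  | Minus of iexp & iexp.

Inductive bexp :=
  | Le of iexp & iexp
  | SameVertex of nat & nat       (* vertex variables *)
  | InSolution of nat             (* vertex variable *)
  | AtEnd of nat                  (* pointer *)
  | Not of bexp
  | And of bexp & bexp.

Inductive instr :=
  | SetI of nat & iexp            (* integer variable *)
  | SetV of nat & nat             (* vertex variables: target, source *)
  | SetCounter of nat & nat & iexp  (* counter, vertex variable *)
  | ReadSec of nat & section & iexp (* vertex variable, section, position *)
  | OpenAdj of nat & nat          (* pointer, vertex variable *)
  | ReadNext of nat & nat         (* vertex variable, pointer *)
  | AddVertex of nat              (* vertex variable *)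
  | DropVertex of nat.            (* vertex variable *)

Inductive prog :=
  | Do of instr
  | Seq of prog & prog
  | If of bexp & prog & prog
  | While of bexp & prog.

(* A vertex variable may hold no vertex; instructions that need one then have
   no effect. A pointer is the part of an adjacency list still to be read. *)
Record state (G : sgraph) := State {
  sol : {set G};
  lay : layout G;
  counter : nat -> G -> int;
  ivar : nat -> int;
  vvar : nat -> option G;
  ptr : nat -> seq G
}.

Definition upd (I : eqType) (A : Type) (f : I -> A) (i : I) (a : A) : I -> A :=
  fun j => if j == i then a else f j.

Definition set_sol (G : sgraph) (st : storage G) (S : {set G}) (s : state G) :=
  State S (relayout st (lay s) (sol s) S) (counter s) (ivar s) (vvar s) (ptr s).
Definition set_counter (G : sgraph) (k : nat) (v : G) (z : int) (s : state G) :=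
  State (sol s) (lay s) (upd (counter s) k (upd (counter s k) v z))
    (ivar s) (vvar s) (ptr s).
Definition set_ivar (G : sgraph) (i : nat) (z : int) (s : state G) :=
  State (sol s) (lay s) (counter s) (upd (ivar s) i z) (vvar s) (ptr s).
Definition set_vvar (G : sgraph) (x : nat) (v : option G) (s : state G) :=
  State (sol s) (lay s) (counter s) (ivar s) (upd (vvar s) x v) (ptr s).
Definition set_ptr (G : sgraph) (p : nat) (l : seq G) (s : state G) :=
  State (sol s) (lay s) (counter s) (ivar s) (vvar s) (upd (ptr s) p l).

(* tau is stored for non-solution vertices only, hence the default 0 on S. *)
Definition stored_tau (G : sgraph) (s : state G) (v : G) : nat :=
  if v \in sol s then 0 else tightness (sol s) v.

Fixpoint ieval (G : sgraph) (s : state G) (e : iexp) : int :=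
  match e with
  | Const z => z
  | IVar i => ivar s i
  | SecSize k => Posz (size (lay s k))
  | Tau x => if vvar s x is Some v then Posz (stored_tau s v) else 0%R
  | Counter k x => if vvar s x is Some v then counter s k v else 0%R
  | Plus e1 e2 => (ieval s e1 + ieval s e2)%R
  | Minus e1 e2 => (ieval s e1 - ieval s e2)%R
  end.

Fixpoint beval (G : sgraph) (s : state G) (b : bexp) : bool :=
  match b with
  | Le e1 e2 => (ieval s e1 <= ieval s e2)%R
  | SameVertex x y => vvar s x == vvar s y
  | InSolution x => if vvar s x is Some v then v \in sol s else false
  | AtEnd p => nilp (ptr s p)
  | Not b1 => ~~ beval s b1
  | And b1 b2 => beval s b1 && beval s b2
  end.

Definition run_instr (G : sgraph) (st : storage G) (c : instr) (s : state G)
    : state G :=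
  match c with
  | SetI i e => set_ivar i (ieval s e) s
  | SetV x y => set_vvar x (vvar s y) s
  | SetCounter k x e =>
      if vvar s x is Some v then set_counter k v (ieval s e) s else s
  | ReadSec x k e =>
      set_vvar x (if ieval s e is Posz m then onth (lay s k) m else None) s
  | OpenAdj p x =>
      if vvar s x is Some v then set_ptr p (adj st v) s else s
  | ReadNext x p =>
      if ptr s p is v :: l then set_vvar x (Some v) (set_ptr p l s) else s
  | AddVertex x =>
      if vvar s x is Some v then set_sol st (v |: sol s) s else s
  | DropVertex x =>
      if vvar s x is Some v then set_sol st (sol s :\ v) s else s
  end.

(* Expressions have a size fixed by the program, so their evaluation is charged
   to the instruction or the test that contains them. *)
Definition cost_instr (G : sgraph) (c : instr) (s : state G) : nat :=
  match c with
  | AddVertex x | DropVertex x => if vvar s x is Some v then (deg v).+1 else 1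
  | _ => 1
  end.

(* exec st p s s' t: started in s, the program p halts in s' after time t. *)
Inductive exec (G : sgraph) (st : storage G)
    : prog -> state G -> state G -> nat -> Prop :=
  | exec_do c s : exec st (Do c) s (run_instr st c s) (cost_instr c s)
  | exec_seq p q s s1 s2 t1 t2 :
      exec st p s s1 t1 -> exec st q s1 s2 t2 ->
      exec st (Seq p q) s s2 (t1 + t2)
  | exec_if b p q s s' t :
      exec st (if beval s b then p else q) s s' t ->
      exec st (If b p q) s s' t.+1
  | exec_while_end b p s :
      ~~ beval s b -> exec st (While b p) s s 1
  | exec_while b p s s1 s2 t1 t2 :
      beval s b -> exec st p s s1 t1 -> exec st (While b p) s1 s2 t2 ->
      exec st (While b p) s s2 (t1 + t2).+1.

Lemma exec_det (G : sgraph) (st : storage G) p s s1 s2 t1 t2 :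
  exec st p s s1 t1 -> exec st p s s2 t2 -> s1 = s2 /\ t1 = t2.
Proof.
move=> H; elim: H s2 t2 => {p s s1 t1}.
- by move=> c s s2 t2 H; inversion H; subst.
- move=> p q s s1 s2 t1 t2 _ IH1 _ IH2 s3 t3 H.
  inversion H as [|? ? ? ? ? ? ? Hp Hq| | |]; subst.
  by case: (IH1 _ _ Hp) => ? ?; subst; case: (IH2 _ _ Hq) => ? ?; subst.
- move=> b p q s s' t _ IH s3 t3 H.
  inversion H as [| |? ? ? ? ? ? Hi| |]; subst.
  by case: (IH _ _ Hi) => ? ?; subst.
- move=> b p s nb s3 t3 H.
  inversion H as [| | | |? ? ? ? ? ? ? hb]; subst => //.
  by rewrite hb in nb.
- move=> b p s s1 s2 t1 t2 hb _ IH1 _ IH2 s3 t3 H.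
  inversion H as [| | |? ? ? nb|? ? ? ? ? ? ? _ Hp Hw]; subst.
    by rewrite hb in nb.
  by case: (IH1 _ _ Hp) => ? ?; subst; case: (IH2 _ _ Hw) => ? ?; subst.
Qed.

(* Main.v *)
(** An improving 2-swap adds exactly one vertex [v], and the removed pair must
    be dominated by [v], so [v] is 2-tight and the pair is [N(v) ∩ S = {x, y}].
    The swap yields a maximal independent set iff every [w] in [N(x) ∪ N(y)]
    is [v], is adjacent to [v], or has a solution neighbour besides [x], [y].
    For one [v] this takes time [O(Δ)]: write 1 on [N(x)], then 2 on [N(y)],
    then 0 on [N[v]]; the mark of [w] in [N(x)] outside [N[v]] is now
    [|N(w) ∩ {x, y}|], and [w] is an obstruction iff [τ(w)] is at most its
    mark. The vertices of [N(y)] are treated symmetrically. If [T_2] is empty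
    the search stops at once, and otherwise [Δ > 0], so the total is
    [O(nΔ + 1)]. *)
Require Import Defs.
From mathcomp Require Import all_boot all_order all_algebra.
From mathcomp Require Import zify.

Set Implicit Arguments.
Unset Strict Implicit.
Unset Printing Implicit Defensive.

(** * Improving 2-swaps and 2-tight vertices *)

Section Swaps.
Variable G : sgraph.
Implicit Types (S : {set G}) (u v w x y : G).

Lemma independentP S :
  reflect {in S &, forall u v, ~~ edge u v} (independent S).
Proof.
apply: (iffP forall_inP) => [H u v uS vS | H u uS].
  by move/forall_inP: (H u uS); apply.
by apply/forall_inP => v vS; apply: H.
Qed.

(** A vertex with no neighbour in [S] could be added to it, while a new vertex of a larger
    independent set has none; so maximality amounts to domination. *)
Lemma solutionP S :
  reflect ({in S &, forall u v, ~~ edge u v} /\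
           forall w, w \notin S -> exists2 u, u \in S & edge w u)
          (is_solution S).
Proof.
apply: (iffP maxsetP) => [[/independentP indS maxS] | [indS domS]].
  split=> // w wS; apply/exists_inP; apply: contraNT wS => /exists_inPn nw.
  rewrite -(maxS (w |: S)) ?setU11 ?subsetUr //; apply/independentP.
  move=> a b /setU1P[->|aS] /setU1P[->|bS]; rewrite ?edge_irrefl //.
  - exact: nw.
  - by rewrite edge_sym; apply: nw.
  - exact: indS.
split; first exact/independentP.
move=> B /independentP indB sSB; apply/eqP; rewrite eqEsubset sSB andbT.
apply/subsetP => w wB; apply: contraT => /domS[u uS].
by rewrite (negPf (indB _ _ wB (subsetP sSB _ uS))).
Qed.

Definition swap S v : {set G} := v |: (S :\: nbrs v).

Lemma swap_in_2nbhd S v :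
  v \in tight S 2 -> is_solution (swap S v) ->
  in_2nbhd S (swap S v) /\ #|swap S v| < #|S|.
Proof.
rewrite inE => /andP[vS /eqP tv] solv; split.
  split=> //; exists (S :&: nbrs v), [set v]; split.
  - exact: subsetIl.
  - by rewrite setIC.
  - by apply/set0Pn; exists v; rewrite inE.
  - by rewrite sub1set inE.
  - by rewrite setDIr setDv set0U setUC.
rewrite /swap cardsU1 -(cardsID (nbrs v) S) setIC -/(tightness S v) tv.
by rewrite ltn_add2r; case: (_ \notin _).
Qed.

(** Since [D] has two elements, the size drop leaves room for a single new vertex [v]. Independence
    of [S'] puts the neighbours of [v] in [S] into [D]; conversely a vertex of [D] lies outside [S']
    and has no neighbour in [S], so only [v] can dominate it. *)
Lemma improving_swapE S S' :
  is_solution S -> in_2nbhd S S' -> #|S'| < #|S| ->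
  exists2 v, v \in tight S 2 & S' = swap S v.
Proof.
move=> /solutionP[indS _] [solS' [D [A [DS cD A0 AS defS']]]] ltS.
have dA : [disjoint S :\: D & A].
  rewrite disjoints_subset; apply/subsetP => w /setDP[wS _].
  by rewrite inE; apply: contraL wS => /(subsetP AS); rewrite inE.
have /cards1P[v defA] : #|A| == 1.
  rewrite eqn_leq card_gt0 A0 andbT -ltnS.
  move: ltS; rewrite defS' cardsU (disjoint_setI0 dA) cards0 subn0.
  by rewrite -(cardsID D S) (setIidPr DS) cD addnC ltn_add2r.
have vS : v \notin S by move: AS; rewrite defA sub1set inE.
move: solS' => /solutionP[indS' domS'].
have vS' : v \in S' by rewrite defS' defA !inE eqxx orbT.
have defD : nbrs v :&: S = D.
  apply/setP => u; rewrite !inE; apply/andP/idP => [[vu uS] | uD].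
    apply: contraTT vu => uD; apply: indS' => //.
    by rewrite defS' !inE uD uS.
  have uS := subsetP DS _ uD; split=> //.
  have: u \notin S'.
    rewrite defS' defA !inE uD /=; apply: contraNneq vS => <- //.
  case/domS' => b; rewrite defS' defA !inE => /orP[/andP[_ bS]|/eqP->].
    by rewrite (negPf (indS _ _ uS bS)).
  by rewrite edge_sym.
exists v; first by rewrite inE vS /tightness defD cD eqxx.
rewrite defS' defA setUC /swap; congr (_ |: _).
by rewrite -defD setDIr setDv setU0.
Qed.

Definition dominated S v x y w :=
  [|| w == v, edge v w | edge x w + edge y w < tightness S w].

Lemma card_nbrs_pair x y w :
  x != y -> #|nbrs w :&: [set x; y]| = edge x w + edge y w.
Proof.
move=> xy; rewrite (setUC [set x]) setIUr cardsU setIACA setIid.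
have -> : [set y] :&: [set x] = set0.
  by apply/setP => u; rewrite !inE; case: eqP => // ->; rewrite eq_sym (negPf xy).
rewrite setI0 cards0 subn0.
have cN u : #|nbrs w :&: [set u]| = edge u w.
  have [uw|uw] := boolP (edge u w).
    by rewrite (setIidPr _) ?cards1 // sub1set inE edge_sym.
  apply/eqP; rewrite cards_eq0; apply/eqP/setP => b; rewrite !inE.
  by case: (b =P u) => [->|]; rewrite ?andbF // edge_sym (negPf uw).
by rewrite !cN addnC.
Qed.

(** Splitting [S] along [nbrs v] gives [tightE], so the strict inequality in [dominated] says that
    [w] has a neighbour in [S :\: nbrs v], the part of [S] that survives. *)
Lemma swap_solutionP S v x y :
  is_solution S -> v \notin S -> x != y -> nbrs v :&: S = [set x; y] ->
  reflect (forall w, edge x w || edge y w -> dominated S v x y w)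
          (is_solution (swap S v)).
Proof.
move=> /solutionP[indS domS] vS xy Nv.
have tightE w : tightness S w =
    edge x w + edge y w + #|nbrs w :&: (S :\: nbrs v)|.
  rewrite -(card_nbrs_pair _ xy) -Nv /tightness -(cardsID (nbrs v)).
  by rewrite setIDA -setIA (setIC S).
apply: (iffP idP) => [/solutionP[_ dom'] w xyw | dom].
  rewrite /dominated; case: eqVneq => //= wv; case: (boolP (edge v w)) => //= vw.
  rewrite tightE -[X in X < _]addn0 ltn_add2l card_gt0; apply/set0Pn.
  (* A vertex of the new set other than [v] lies in [S], hence is adjacent to neither [x] nor
     [y]. *)
  have [wS|wS] := boolP (w \in swap S v).
    move: wS; rewrite !inE (negPf wv) (negPf vw) /= => wS.
    have xS : x \in S by have := set21 x y; rewrite -Nv inE => /andP[].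
    have yS : y \in S by have := set22 x y; rewrite -Nv inE => /andP[].
    by move: xyw; rewrite (negPf (indS _ _ xS wS)) (negPf (indS _ _ yS wS)).
  case: (dom' w wS) => u; rewrite !inE => /orP[/eqP->|uS wu].
    by rewrite edge_sym (negPf vw).
  by exists u; rewrite !inE wu.
apply/solutionP; split.
  move=> a b; rewrite !inE => /orP[/eqP->|/andP[va aS]] /orP[/eqP->|/andP[vb bS]].
  - by rewrite edge_irrefl.
  - by [].
  - by rewrite edge_sym.
  - exact: indS.
move=> w wS'.
have [vw|vw] := boolP (edge v w).
  by exists v; rewrite ?setU11 // edge_sym.
have wv : w != v by apply: contraNneq wS' => ->; rewrite setU11.
have wS : w \notin S.
  by apply: contra wS' => wS; rewrite !inE vw wS orbT.
have [u] : exists u, u \in nbrs w :&: (S :\: nbrs v).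
  (* If [w] is adjacent to neither [x] nor [y], whatever dominated it in [S] survives the swap. *)
  have [xyw|] := boolP (edge x w || edge y w).
    have := dom w xyw; rewrite /dominated (negPf wv) (negPf vw) /=.
    by rewrite tightE -[X in X < _]addn0 ltn_add2l card_gt0 => /set0Pn.
  rewrite negb_or => /andP[xw yw]; have [u uS wu] := domS w wS; exists u.
  rewrite !inE wu uS andbT; apply/negP => vu.
  have : u \in [set x; y] by rewrite -Nv !inE vu.
  by rewrite !inE => /orP[]/eqP eu; subst u;
    rewrite edge_sym ?(negPf xw) ?(negPf yw) in wu.
by rewrite !inE => /andP[wu uS]; exists u; rewrite // !inE uS orbT.
Qed.

Lemma leq_deg_maxdeg v : deg v <= maxdeg G.
Proof. exact: leq_bigmax. Qed.

End Swaps.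

(** * Total correctness triples with time bounds *)

Section TimedTriples.
Variables (G : sgraph) (st : storage G).
Implicit Types (p q body : prog) (s : state G) (Q : state G -> Prop).

(** By [exec_det] the existential speaks of the only halting run. *)
Definition runs p T s Q := exists s' t, [/\ exec st p s s' t, t <= T & Q s'].

Lemma runs_weaken p T T' s Q Q' :
  runs p T s Q -> T <= T' -> (forall s', Q s' -> Q' s') -> runs p T' s Q'.
Proof.
case=> s' [t [ex tT Qs]] le sub; exists s', t.
by split=> //; [apply: leq_trans tT le | apply: sub].
Qed.

Lemma runs_leq p T T' s Q : T <= T' -> runs p T s Q -> runs p T' s Q.
Proof. by move=> le H; apply: runs_weaken H le _. Qed.

Lemma runs_do c s Q : Q (run_instr st c s) -> runs (Do c) (cost_instr c s) s Q.
Proof. by move=> Qs; do 2 eexists; split; [apply: exec_do | | exact: Qs]. Qed.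

(** The triple for [q] serves as postcondition of [p]; its bound [T2] is the same for all
    intermediate states. *)
Lemma runs_seq p q T1 T2 s Q :
  runs p T1 s (fun s1 => runs q T2 s1 Q) -> runs (Seq p q) (T1 + T2) s Q.
Proof.
case=> s1 [t1 [ex1 le1 [s2 [t2 [ex2 le2 Q2]]]]].
by exists s2, (t1 + t2); split=> //; [apply: exec_seq ex1 ex2 | apply: leq_add].
Qed.

Lemma runs_if b p q T s Q :
  (beval s b -> runs p T s Q) -> (~~ beval s b -> runs q T s Q) ->
  runs (If b p q) T.+1 s Q.
Proof.
move=> Hp Hq.
have [s' [t [ex le Qs]]] : runs (if beval s b then p else q) T s Q.
  by case: ifPn.
by exists s', t.+1; split=> //; apply: exec_if.
Qed.

Lemma runs_while_end b p s Q : ~~ beval s b -> Q s -> runs (While b p) 1 s Q.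
Proof. by move=> nb Qs; exists s, 1; split=> //; apply: exec_while_end. Qed.

Lemma runs_while_step b p T1 T2 s Q :
  beval s b -> runs p T1 s (fun s1 => runs (While b p) T2 s1 Q) ->
  runs (While b p) (T1 + T2).+1 s Q.
Proof.
move=> hb [s1 [t1 [ex1 le1 [s2 [t2 [ex2 le2 Q2]]]]]].
exists s2, (t1 + t2).+1; split=> //; first exact: exec_while hb ex1 ex2.
by rewrite ltnS leq_add.
Qed.

End TimedTriples.

(* Register conventions. Vertices: 0 is the candidate [v], 1 and 2 are its
   solution neighbours [x] and [y], 3 runs over adjacency lists. Integers: 0 is
   the verdict, 1 the position in [T_2], 2 tells whether [v] is still viable. The language has
   no empty program: [SetV 3 3] stands for it. *)
Definition for_adj (a : nat) (body : prog) : prog :=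
  Seq (Do (OpenAdj 0 a)) (While (Not (AtEnd 0)) (Seq (Do (ReadNext 3 0)) body)).

Definition mark (a : nat) (z : int) : prog :=
  for_adj a (Do (SetCounter 0 3 (Const z))).

Definition find_pair : prog :=
  for_adj 0 (If (InSolution 3) (Seq (Do (SetV 1 2)) (Do (SetV 2 3)))
                (Do (SetV 3 3))).

Definition test (a : nat) : prog :=
  for_adj a (If (Le (Tau 3) (Counter 0 3)) (Do (SetI 2 (Const 0%R)))
                (Do (SetV 3 3))).

Definition check_side (a b : nat) : prog :=
  Seq (mark a 1%R) (Seq (mark b 2%R) (Seq (mark 0 0%R)
    (Seq (Do (SetCounter 0 0 (Const 0%R))) (test a)))).

Definition do_swap : prog :=
  Seq (Do (DropVertex 1)) (Seq (Do (DropVertex 2))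
    (Seq (Do (AddVertex 0)) (Do (SetI 0 (Const 1%R))))).

Definition try_candidate : prog :=
  Seq (Do (ReadSec 0 SecT2 (IVar 1)))
  (Seq (Do (SetI 1 (Plus (IVar 1) (Const 1%R))))
  (Seq find_pair
  (Seq (Do (SetI 2 (Const 1%R)))
  (Seq (check_side 1 2)
  (Seq (check_side 2 1)
    (If (Le (Const 1%R) (IVar 2)) do_swap (Do (SetV 3 3)))))))).

Definition two_swap_search : prog :=
  Seq (Do (SetI 0 (Const 0%R))) (Seq (Do (SetI 1 (Const 0%R)))
    (While (And (Le (IVar 0) (Const 0%R))
                (Le (Plus (IVar 1) (Const 1%R)) (SecSize SecT2)))
       try_candidate)).

(** * Correctness and cost of the search program *)

Section Correctness.
Variables (G : sgraph) (st : storage G).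
Implicit Types (S : {set G}) (u v w x y : G) (s : state G) (L : layout G).
Implicit Types (z : nat -> int) (e : nat -> option G).

(** Vertex variable 3, the pointers and the counters stay free as scratch space. *)
Definition holds S L z e s :=
  [/\ sol s = S, lay s = L, ivar s =1 z & forall a, a < 3 -> vvar s a = e a].

Lemma size_adj v : size (adj st v) <= maxdeg G.
Proof.
apply: leq_trans (leq_deg_maxdeg v); rewrite /deg -(card_uniqP (adj_uniq st v)).
by rewrite (eq_card (adj_nbrs st v)).
Qed.

Lemma mem_adj v w : (w \in adj st v) = edge v w.
Proof. by rewrite adj_nbrs inE. Qed.

(** The invariant is indexed by the unread part of the list. A round costs [T] plus one guard test
    and one [ReadNext]; the extra round in [(maxdeg G).+1] pays for [OpenAdj] and the last test. *)
Lemma runs_for_adj a body T (I : seq G -> state G -> Prop) s u :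
  vvar s a = Some u ->
  I (adj st u) (set_ptr 0 (adj st u) s) ->
  (forall w l s1, ptr s1 0 = w :: l -> {subset w :: l <= adj st u} ->
     I (w :: l) s1 ->
     runs st body T (set_vvar 3 (Some w) (set_ptr 0 l s1))
       (fun s2 => ptr s2 0 = l /\ I l s2)) ->
  runs st (for_adj a body) ((T + 2) * (maxdeg G).+1) s (I [::]).
Proof.
move=> su I0 step.
have loop l s1 : ptr s1 0 = l -> {subset l <= adj st u} -> I l s1 ->
    runs st (While (Not (AtEnd 0)) (Seq (Do (ReadNext 3 0)) body))
      ((T + 2) * size l + 1) s1 (I [::]).
  elim: l s1 => [|w l IH] s1 pl sub Il.
    by rewrite muln0; apply: runs_while_end => //=; rewrite pl.
  have -> : (T + 2) * size (w :: l) + 1 = (1 + T + ((T + 2) * size l + 1)).+1.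
    by rewrite /= mulnS addn2 !addnA add1n.
  apply: runs_while_step; first by rewrite /= pl.
  apply: runs_seq; apply: (runs_do (c := ReadNext 3 0)) => /=; rewrite pl.
  apply: runs_weaken (step _ _ _ pl sub Il) (leqnn _) _ => s2 [pl2 I2].
  by apply: IH => // b bl; apply: sub; rewrite inE bl orbT.
apply: (@runs_leq _ _ _ (1 + ((T + 2) * size (adj st u) + 1))).
  rewrite addnC -addnA (mulnS _ (maxdeg G)) addnC leq_add ?leq_addl //.
  by rewrite leq_mul2l size_adj orbT.
apply: runs_seq; apply: (runs_do (c := OpenAdj 0 a)) => /=; rewrite su.
exact: loop.
Qed.

Lemma runs_mark S L z e a k s u :
  a < 3 -> e a = Some u -> holds S L z e s ->
  runs st (mark a k) (3 * (maxdeg G).+1) s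
    (fun s' => holds S L z e s' /\
       forall w, counter s' 0 w = if edge u w then k else counter s 0 w).
Proof.
move=> a3 ea hs.
(* For an unread vertex the equation is trivial, so nothing is claimed about its counter. *)
pose I (l : seq G) s' := holds S L z e s' /\
  (forall w, counter s' 0 w = if w \in l then counter s' 0 w
                             else if edge u w then k else counter s 0 w).
have hs' : vvar s a = Some u by case: hs => _ _ _ ->.
apply: (runs_weaken (runs_for_adj (T := 1) (I := I) hs' _ _)) => //.
- split; first by case: hs.
  by move=> w; rewrite mem_adj; case: (edge u w).
- move=> w l s1 _ sub [[h1 h2 h3 h4] hc].
  apply: (runs_do (c := SetCounter _ _ _)) => /=; split=> //; split.
    by split=> // b b3 /=; rewrite /upd; case: eqP b3 => [->|_ /h4].
  have uw : edge u w by rewrite -mem_adj sub ?mem_head.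
  move=> b /=; rewrite /upd /=; have [->|bw] := eqVneq b w.
    by rewrite uw if_same.
  by rewrite hc inE (negPf bw) /=; case: ifP.
Qed.

Lemma runs_test S L z e a s u (c := counter s 0)
    (ok := fun w => (c w < Posz (tightness S w))%R) :
  a < 3 -> e a = Some u -> u \in S -> is_solution S -> holds S L z e s ->
  runs st (test a) (4 * (maxdeg G).+1) s
    (holds S L (upd z 2 (if all ok (adj st u) then z 2 else 0%R)) e).
Proof.
move=> a3 ea uS /solutionP[indS _] hs.
set z' := upd z 2 _.
(* The last clause predicts the final flag from the current one and the pending tests; this
   prediction never changes. *)
pose I (l : seq G) s' := [/\ sol s' = S, lay s' = L, counter s' 0 =1 c,
  forall b, b < 3 -> vvar s' b = e b &
  upd (ivar s') 2 (if all ok l then ivar s' 2 else 0%R) =1 z'].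
have hs' : vvar s a = Some u by case: hs => _ _ _ ->.
have {hs} [h1 h2 h3 h4] := hs.
apply: (runs_weaken (runs_for_adj (T := 2) (I := I) hs' _ _)) => [|||s'] //.
- by split=> //= i; rewrite /z' /upd !h3.
- move=> w l s1 _ sub [k1 k2 k3 k4 k5].
  have uw : edge u w by rewrite -mem_adj sub ?mem_head.
  (* Outside [S] the stored value is the true tightness. *)
  have wS : w \notin S by apply: contraL uw => wS; apply: indS.
  have vv b : b < 3 -> upd (vvar s1) 3 (Some w) b = e b.
    by rewrite /upd; case: eqP => [->|_ /k4].
  apply: runs_if => /=; rewrite /stored_tau /= k1 (negPf wS) k3 => hle;
    [apply: (runs_do (c := SetI _ _)) | apply: (runs_do (c := SetV _ _))];
    split=> //; split=> //= i; move: (k5 i); rewrite /upd /= /ok.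
  + by rewrite Order.TotalTheory.ltNge hle /= if_same; case: eqP.
  + by move=> _; case: eqP => [->|_ /k4].
  + by rewrite Order.TotalTheory.ltNge hle.
- move=> [k1 k2 _ k4 k5]; split=> // i; rewrite -k5 /upd.
  by case: eqP => // ->.
Qed.

Lemma runs_find_pair S L z e s v :
  e 0 = Some v -> v \in tight S 2 -> holds S L z e s ->
  runs st find_pair (5 * (maxdeg G).+1) s
    (fun s' => exists x y, [/\ x != y, nbrs v :&: S = [set x; y] &
       holds S L z (upd (upd e 1 (Some x)) 2 (Some y)) s']).
Proof.
move=> e0 vT [h1 h2 h3 h4].
have [x [y [fE xy]]] :
    exists x y, [seq u <- adj st v | u \in S] = [:: x; y] /\ x != y.
  have unf : uniq [seq u <- adj st v | u \in S] by rewrite filter_uniq ?adj_uniq.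
  have: size [seq u <- adj st v | u \in S] = 2.
    move: vT; rewrite inE => /andP[_ /eqP <-].
    rewrite -(card_uniqP unf); apply: eq_card => w.
    by rewrite mem_filter adj_nbrs !inE andbC.
  case: (filter _ _) unf => [|x [|y []]] //=; rewrite inE andbT => xy _.
  by exists x, y.
have Nv : nbrs v :&: S = [set x; y].
  apply/setP => w; have := mem_filter (fun u => u \in S) w (adj st v).
  by rewrite fE mem_adj !inE andbC => ->.
(* Variables 1 and 2 act as a queue holding the last two solution neighbours read. There are exactly
   two, so the initial contents are pushed out. *)
pose shift (p : option G * option G) u := (p.2, Some u).
pose I (l : seq G) s' := [/\ sol s' = S, lay s' = L, ivar s' =1 z,
    vvar s' 0 = e 0 &
  foldl shift (vvar s' 1, vvar s' 2) [seq u <- l | u \in S] = (Some x, Some y)].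
have s0 : vvar s 0 = Some v by rewrite h4.
apply: (runs_weaken (runs_for_adj (T := 3) (I := I) s0 _ _)) => //.
- by split=> //=; rewrite ?h4 // fE.
- move=> w l s1 _ sub [k1 k2 k3 k4 k5].
  apply: runs_if => /=; rewrite k1 => wS; last first.
    apply: (runs_weaken (runs_do (c := SetV _ _)
      (Q := fun s2 => ptr s2 0 = l /\ I l s2) _)) => //=.
    by split=> //; split=> //=; move: k5; rewrite /= (negPf wS).
  apply: (@runs_seq _ _ _ _ 1 1).
  apply: (runs_do (c := SetV _ _)); apply: (runs_do (c := SetV _ _)).
  by split=> //; split=> //=; move: k5; rewrite /= wS.
- move=> s' [k1 k2 k3 k4 [k5 k6]]; exists x, y; split=> //; split=> //.
  by case=> [|[|[|]]].
Qed.

Lemma runs_check_side S L z e s v a b x y :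
  is_solution S -> x \in S ->
  0 < a < 3 -> b < 3 -> e 0 = Some v -> e a = Some x -> e b = Some y ->
  holds S L z e s ->
  runs st (check_side a b) (14 * (maxdeg G).+1) s
    (holds S L (upd z 2 (if all (dominated S v x y) (adj st x) then z 2
                         else 0%R)) e).
Proof.
move=> solS xS /andP[a0 a3] b3 e0 ea eb hs.
have leT : 3 * (maxdeg G).+1 + (3 * (maxdeg G).+1 + (3 * (maxdeg G).+1 +
    (1 + 4 * (maxdeg G).+1))) <= 14 * (maxdeg G).+1.
  lia.
apply: (runs_leq leT).
apply: runs_seq.
apply: runs_weaken (runs_mark _ a3 ea hs) (leqnn _) _ => s1 [hs1 c1].
apply: runs_seq.
apply: runs_weaken (runs_mark _ b3 eb hs1) (leqnn _) _ => s2 [hs2 c2].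
apply: runs_seq.
apply: runs_weaken (runs_mark _ _ e0 hs2) (leqnn _) _ => // s3 [hs3 c3].
apply: runs_seq; apply: (runs_do (c := SetCounter _ _ _)) => /=.
have v3 : vvar s3 0 = Some v by case: hs3 => _ _ _ ->.
rewrite v3; set s4 := set_counter _ _ _ _.
have hs4 : holds S L z e s4 by case: hs3.
have c4 w : edge x w ->
    ((counter s4 0 w < Posz (tightness S w))%R = dominated S v x y w).
  (* The mark 0 on [v] and its neighbours makes them pass only because the tightness is positive,
     [x] being a solution neighbour of [w]. *)
  move=> xw; have tw : 0 < tightness S w.
    by apply/card_gt0P; exists x; rewrite !inE edge_sym xw.
  rewrite /= /upd /= /dominated c3 c2 c1 xw.
  by case: eqP => //= _; case: (edge v w) => //=; case: (edge y w).
apply: runs_weaken (runs_test a3 ea xS solS hs4) (leqnn _) _ => s5.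
rewrite (eq_in_all (a2 := dominated S v x y)) // => w; rewrite mem_adj.
exact: c4.
Qed.

Lemma dominatedC S v x y : dominated S v x y =1 dominated S v y x.
Proof. by move=> w; rewrite /dominated (addnC (edge x w)). Qed.

Definition found S s :=
  ivar s 0 = 1%R /\ in_2nbhd S (sol s) /\ #|sol s| < #|S|.

Lemma runs_do_swap S s v x y :
  v \in tight S 2 -> is_solution (swap S v) -> nbrs v :&: S = [set x; y] ->
  sol s = S -> vvar s 0 = Some v -> vvar s 1 = Some x -> vvar s 2 = Some y ->
  runs st do_swap (4 * (maxdeg G).+1) s (found S).
Proof.
move=> vT solv Nv sS s0 s1 s2.
have leT : (deg x).+1 + ((deg y).+1 + ((deg v).+1 + 1)) <= 4 * (maxdeg G).+1.
  by rewrite !mulSn mul0n addn0 !leq_add // ltnS leq_deg_maxdeg.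
apply: (runs_leq leT); rewrite /do_swap.
have dcost c s3 Q T : cost_instr c s3 = T -> Q (run_instr st c s3) ->
    runs st (Do c) T s3 Q by move=> <-; apply: runs_do.
apply/runs_seq/dcost; rewrite /= s1 //.
apply/runs_seq/dcost; rewrite /= s2 //.
apply/runs_seq/dcost; rewrite /= s0 //.
apply: dcost => //=; rewrite sS.
have -> : v |: S :\ x :\ y = swap S v.
  rewrite /swap; congr (_ |: _); have -> : S :\: nbrs v = S :\: (nbrs v :&: S).
    by rewrite setDIr setDv setU0.
  by rewrite Nv -setDDl.
by split=> //; apply: swap_in_2nbhd.
Qed.

(* Before the swap the sections must stay those of [S], as the scan of [T_2]
   reads them by position. *)
Definition scanning S L (i : nat) s :=
  [/\ sol s = S, lay s = L, ivar s 0 = 0%R, ivar s 1 = Posz i &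
      all (fun v => ~~ is_solution (swap S v)) (take i (L SecT2))].

Lemma runs_try_candidate S L i s :
  is_solution S -> layout_of S L -> i < size (L SecT2) -> scanning S L i s ->
  runs st try_candidate (41 * (maxdeg G).+1) s
    (fun s' => found S s' \/ scanning S L i.+1 s').
Proof.
move=> solS layL iT [h1 h2 h3 h4 h5].
(* The loops and the swap total 37 multiples of [(maxdeg G).+1]; the four unit costs are rounded up
   to four more. *)
have leT : 1 + (1 + (5 * (maxdeg G).+1 + (1 + (14 * (maxdeg G).+1 +
    (14 * (maxdeg G).+1 + (4 * (maxdeg G).+1).+1))))) <= 41 * (maxdeg G).+1.
  lia.
apply: (runs_leq leT); rewrite /try_candidate.
apply/runs_seq/(runs_do (c := ReadSec _ _ _)); rewrite /= h4 h2.
case Lv: (onth (L SecT2) i) (onthTE (L SecT2) i) => /= [v|]; last by rewrite iT.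
move=> _.
have takeE : take i.+1 (L SecT2) = rcons (take i (L SecT2)) v.
  by rewrite (take_nth v) //; congr rcons; apply: onth_nth.
have vT : v \in tight S 2.
  by have [_ <-] := layL SecT2; apply/onthP; exists i.
apply/runs_seq/(runs_do (c := SetI _ _)) => /=.
set s1 := set_ivar _ _ _.
have hs1 : holds S L (ivar s1) (vvar s1) s1 by split.
apply: runs_seq; apply: (runs_weaken (runs_find_pair (v := v) _ vT hs1)) => //.
move=> s2 [x [y [xy Nv [g1 g2 g3 g4]]]].
have xS : x \in S by have := set21 x y; rewrite -Nv inE => /andP[].
have yS : y \in S by have := set22 x y; rewrite -Nv inE => /andP[].
set e := upd _ 2 _ in g4.
apply/runs_seq/(runs_do (c := SetI _ _)) => /=.
have hs3 : holds S L (upd (ivar s1) 2 1%R) e (set_ivar 2 1%R s2).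
  by split=> // j; rewrite /= /upd g3.
set s3 := set_ivar 2 _ _ in hs3 *.
apply: runs_seq.
apply: (runs_weaken (runs_check_side (v := v) (x := x) (y := y)
  solS xS _ _ _ _ _ hs3)) => // s4 hs4.
apply: runs_seq.
apply: (runs_weaken (runs_check_side (v := v) (x := y) (y := x)
  solS yS _ _ _ _ _ hs4)) => // s5 [k1 k2 k3 k4].
have vS : v \notin S by move: vT; rewrite inE => /andP[].
have domE : all (dominated S v x y) (adj st x) &&
    all (dominated S v y x) (adj st y) = is_solution (swap S v).
  rewrite (eq_all (dominatedC S v y x)).
  apply/andP/(swap_solutionP solS vS xy Nv) => [[/allP dx /allP dy] w | dom].
    by case/orP => ?; [apply: dx | apply: dy]; rewrite mem_adj.
  by split; apply/allP => w; rewrite mem_adj => hw; apply: dom;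
    rewrite hw ?orbT.
(* A flag cleared by the first side stays cleared on the second. *)
have v2 : ivar s5 2 = if is_solution (swap S v) then 1%R else 0%R.
  by rewrite k3 -domE /upd /=; do 2!case: all.
apply: runs_if => /=; rewrite v2; case: ifP => // solv _.
  apply: runs_weaken (runs_do_swap vT solv Nv k1 _ _ _) (leqnn _) _.
  - exact: k4.
  - exact: k4.
  - exact: k4.
  - by left.
apply: (runs_weaken (runs_do (c := SetV _ _) (Q := scanning S L i.+1) _)) => //.
- split=> //=; rewrite ?k3 /upd /= ?h3 //.
    by rewrite /upd /= h4; lia.
  by rewrite takeE all_rcons solv.
- by right.
Qed.

Lemma runs_search_loop S L i s b :
  is_solution S -> layout_of S L -> size (L SecT2) = i + b ->
  scanning S L i s ->
  runs st (While (And (Le (IVar 0) (Const 0%R))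
                (Le (Plus (IVar 1) (Const 1%R)) (SecSize SecT2)))
       try_candidate) ((41 * (maxdeg G).+1 + 1) * b + 1) s
    (fun s' => found S s' \/ scanning S L (size (L SecT2)) s').
Proof.
move=> solS layL; elim: b i s => [|b IH] i s sT sc.
  have [h1 h2 h3 h4 _] := sc; rewrite muln0; apply: runs_while_end => /=.
    by rewrite h2 h4 sT addn0; lia.
  by right; rewrite sT addn0.
have [h1 h2 h3 h4 _] := sc; set A := 41 * _ in IH *.
have -> : (A + 1) * b.+1 + 1 = (A + ((A + 1) * b + 1)).+1 by lia.
apply: runs_while_step; first by rewrite /= h2 h3 h4 sT; lia.
have iT : i < size (L SecT2) by rewrite sT addnS ltnS leq_addr.
apply: runs_weaken (runs_try_candidate solS layL iT sc) (leqnn _) _ => s1 [fs|].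
  (* Verdict 1 falsifies the guard whatever the sections of the new solution are. *)
  apply: (@runs_leq _ _ _ 1); first by rewrite addn1.
  by apply: runs_while_end; [case: fs => /= -> | left].
by apply: IH; rewrite sT addSnnS.
Qed.

End Correctness.

(* The verdict is left in integer variable 0: 1 if an improving solution was
   found, which is then the current solution of the data structure, and 0 if S
   is declared 2-minimal. *)
Theorem theorem5 :
  exists (p : prog) (K : nat),
  forall (G : sgraph) (st : storage G) (S : {set G}) (s : state G),
    is_solution S -> sol s = S -> layout_of S (lay s) ->
    exists (s' : state G) (t : nat),
      [/\ exec st p s s' t,
          t <= K * (#|G| * maxdeg G + 1)
        & (ivar s' 0 = 1%R /\ in_2nbhd S (sol s') /\ #|sol s'| < #|S|)
          \/ (ivar s' 0 = 0%R /\ two_minimal S)].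
Proof.
(* For [m <= #|G|] and positive [maxdeg G] the cost is at most 83 times [#|G| * maxdeg G], plus 3;
   90 leaves slack. *)
exists two_swap_search, 90 => G st S s solS sS layS.
set L := lay s in layS.
pose m := size (L SecT2).
have [s' [t [ex le Q]]] : runs st two_swap_search
    (1 + (1 + ((41 * (maxdeg G).+1 + 1) * m + 1))) s
    (fun s' => found S s' \/ scanning S L m s').
  apply/runs_seq/(runs_do (c := SetI _ _)) => /=.
  apply/runs_seq/(runs_do (c := SetI _ _)) => /=.
  by apply: (@runs_search_loop _ _ _ _ 0) => //; split=> //; rewrite take0.
exists s', t; split=> //.
  apply: leq_trans le _.
  have [uT mT] := layS SecT2.
  have mG : m <= #|G| by rewrite /m -(card_uniqP uT) max_card.
  (* With no candidate the cost is 3, absorbed by the [+ 1] of the bound even if [maxdeg G] is 0. *)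
  have [->|m0] := posnP m; first by lia.
  have d0 : 0 < maxdeg G.
    have /hasP[v vT _] : has predT (L SecT2) by rewrite has_predT.
    move: vT; rewrite mT inE => /andP[_ /eqP tv].
    apply: leq_trans (leq_deg_maxdeg v).
    apply: leq_trans (subset_leq_card (subsetIl _ S)).
    by rewrite -/(tightness S v) tv.
  nia.
case: Q => [|[h1 h2 h3 h4 /allP nosol]]; first by left.
right; split=> // S' inS' ltS'.
have [v vT defS'] := improving_swapE solS inS' ltS'.
case: inS' => solS' _; have [_ mT] := layS SecT2.
by have := nosol v; rewrite take_size mT -defS' solS' => /(_ vT).
Qed.
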